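(* The following hold as $n\to\infty$: (i) $C_3(n,\mathrm{SP}_3)=\Omega\!\left(\left(\frac{\log n}{\log\log n}\right)^{1/8}\right)$; (ii) $C_3(n,\mathrm{SP}^1_4)=\Omega(n^{1/8})$ and $C_3(n,\mathrm{SP}^2_4)=\Omega(n^{1/7})$; (iii) for every $t\ge 5$, $C_3(n,\mathrm{SP}^1_t)=\Omega(n^{1/3})$ and $C_3(n,\mathrm{SP}^2_t)=\Omega(n^{1/3})$.
   Context: An $r$-graph is an $r$-uniform hypergraph; $K_n^{(r)}$ is the complete $r$-graph on $n$ vertices. A copy of an $r$-graph $H$ in $K_n^{(r)}$ is a subhypergraph isomorphic to $H$. An $(n,r,H)$-local coloring with $k$ colors is a family of edge-colorings $f_v:E(K_n^{(r)})\to[k]$, one per vertex $v$, such that for every copy $T$ of $H$ there is $u\in V(T)$ with $f_u$ injective on $E(T)$. $C_r(n,H)$ is the minimum such $k$. $\mathrm{SP}_3$: vertex set $\{a,b,c,d,e,f\}$, edges $\{a,b,c\},\{b,c,d\},\{d,e,f\}$. For $t\ge 1$, $\mathrm{SP}^1_t$ is the $3$-graph with edges $e_j=\{v_{s_j},v_{s_j+1},v_{s_j+2}\}$, $j=1,\dots,t$, where $s_1=1$, $s_{j+1}=s_j+2$ for odd $j$ and $s_{j+1}=s_j+1$ for even $j$ (so its edges are $\{v_1,v_2,v_3\},\{v_3,v_4,v_5\},\{v_4,v_5,v_6\},\{v_6,v_7,v_8\},\dots$ and it has $\lceil (3t+3)/2\rceil$ vertices). $\mathrm{SP}^2_t$ is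 defined the same way but with $s_{j+1}=s_j+1$ for odd $j$ and $s_{j+1}=s_j+2$ for even $j$ (edges $\{v_1,v_2,v_3\},\{v_2,v_3,v_4\},\{v_4,v_5,v_6\},\{v_5,v_6,v_7\},\dots$; it has $\lceil (3t+2)/2\rceil$ vertices). Thus consecutive edges alternately share one and two vertices. *)

(* Defs.v *)
From mathcomp Require Import all_boot.
From Stdlib Require Import Reals.
Set Implicit Arguments. Unset Strict Implicit. Unset Printing Implicit Defensive.

(* A (small) hypergraph H: vertex set {0, ..., hv H - 1}, edges given as
   lists of vertices (each edge is the set of vertices in the list). *)
Record hgraph := HGraph { hv : nat; hedges : seq (seq nat) }.

Definition copy_edges (n : nat) (H : hgraph) (phi : nat -> 'I_n) : seq {set 'I_n} :=
  [seq [set:: map phi e] | e <- hedges H].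

Definition embedding (n : nat) (H : hgraph) (phi : nat -> 'I_n) : Prop :=
  forall i j, i < hv H -> j < hv H -> phi i = phi j -> i = j.

Definition local_coloring (r n : nat) (H : hgraph) (k : nat) : Prop :=
  exists f : 'I_n -> {set 'I_n} -> nat,
    (forall u (e : {set 'I_n}), #|e| = r -> f u e < k) /\
    (forall phi : nat -> 'I_n, embedding H phi ->
       exists2 u, (exists2 i, i < hv H & u = phi i) &
         {in copy_edges H phi &, injective (f u)}).

Definition SP3 : hgraph := HGraph 6 [:: [:: 0; 1; 2]; [:: 1; 2; 3]; [:: 3; 4; 5]].

(* Starting indices (0-indexed vertices and edges): edge i is
   {s i, s i + 1, s i + 2}.  Paper: s_{j+1} = s_j + 2 (j odd) / + 1 (j even)
   for SP^1, the opposite for SP^2; here edge i corresponds to j = i+1. *)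
Fixpoint sp1_s (i : nat) : nat :=
  match i with 0 => 0 | i'.+1 => sp1_s i' + (if odd i' then 1 else 2) end.
Fixpoint sp2_s (i : nat) : nat :=
  match i with 0 => 0 | i'.+1 => sp2_s i' + (if odd i' then 2 else 1) end.

Definition SP_of (s : nat -> nat) (t : nat) : hgraph :=
  HGraph (s t.-1 + 3) (mkseq (fun i => [:: s i; (s i).+1; (s i).+2]) t).

Definition SP1 (t : nat) : hgraph := SP_of sp1_s t.
Definition SP2 (t : nat) : hgraph := SP_of sp2_s t.

(* "C_r(n,H) >= c * g n for all n >= N", via the definition of C_r as a minimum. *)
Definition C_lower (r : nat) (H : hgraph) (c : R) (N : nat) (g : nat -> R) : Prop :=
  forall n k, (N <= n)%nat -> local_coloring r n H k -> (c * g n <= INR k)%R.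

Definition big_Omega (r : nat) (H : hgraph) (g : nat -> R) : Prop :=
  exists c : R, (0 < c)%R /\ exists N : nat, C_lower r H c N g.

Example SP1_4 : hedges (SP1 4) = [:: [:: 0;1;2]; [:: 2;3;4]; [:: 3;4;5]; [:: 5;6;7]] /\ hv (SP1 4) = 8.
Proof. by []. Qed.
Example SP2_4 : hedges (SP2 4) = [:: [:: 0;1;2]; [:: 1;2;3]; [:: 3;4;5]; [:: 4;5;6]] /\ hv (SP2 4) = 7.
Proof. by []. Qed.

(* Main.v *)
(* All copies are built from edges [x P] with [x] a vertex and [P] a pair, the
   pairs being disjoint. A vertex is served when two edges of the copy get the
   same color from it; with few colors we exhibit a copy with all vertices served.

   SP3 (edges xP, Py, yQ): on k^2 + 1 pairs, two vertices x, y look alike to all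
   vertices of all pairs; then two pairs P, Q are not distinguished by x and y
   at y.

   SP1 4 (edges Px, xQ, Qy, yR): by Cauchy-Schwarz a fraction about 1/k^2 of the
   triples (P, Q, R) gets a single color at x from x, so some triple has this
   property for about n/k^2 vertices x; two of them, x and y, are not
   distinguished at Q by the six vertices of P, Q, R.

   SP2 4 (edges xP, Py, yQ, Qz): by Cauchy-Schwarz there are many (x, y, P, Q) such
   that P does not distinguish xP from yP, Q does not distinguish xQ from yQ, and
   neither x nor y distinguishes yP from yQ. Some (y, P, Q) occurs with two
   different x, which serve as x and z.

   t >= 5: two edges xP, Py sharing a pair are chosen so that they serve about n/k
   vertices; among these, two triples meeting in one vertex get the same colors
   from the four vertices of xP and Py. Both configurations occur in SP1 t and in
   SP2 t, and the remaining vertices are taken among the n/k served ones. *)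

Require Import Defs.
From mathcomp Require Import all_boot.
From Stdlib Require Import Reals.
From mathcomp Require Import ssrnat zify.
From Stdlib Require Import Lra.

Set Implicit Arguments.
Unset Strict Implicit.
Unset Printing Implicit Defensive.

(** * Local colorings as colorings of vertex lists *)

Definition three_uniform (H : hgraph) : bool :=
  all (fun e => [&& size e == 3, uniq e & all (gtn (hv H)) e]) (hedges H).

(** This is the failure of injectivity at [u]. Between 3-sets, [~~ all (mem e') e] says that the two
    edges are distinct, whatever the order of their vertices. *)
Definition served (H : hgraph) (K : finType) (col : nat -> seq nat -> K)
    (s : seq nat) (u : nat) : Prop :=
  exists e e', [/\ e \in hedges H, e' \in hedges H, ~~ all (mem e') e &
    col u (map (nth 0 s) e) = col u (map (nth 0 s) e')].

(* A local coloring with the vertices of K_n renamed 0, ..., n - 1 and edges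
   given as lists; [s] lists the images of the vertices of a copy of [H]. *)
Definition separating (n : nat) (H : hgraph) (K : finType)
    (col : nat -> seq nat -> K) : Prop :=
  (forall u e e', e =i e' -> col u e = col u e') /\
  (forall s, uniq s -> all (gtn n) s -> size s = hv H ->
     ~ {in s, forall u, served H col s u}).

(** A list [s] with all vertices served is a copy without the vertex that the local coloring
    promises. With [2 < n] there is an edge, so some color exists. *)
Lemma separating_of_local (H : hgraph) (n k : nat) :
  three_uniform H -> 2 < n -> local_coloring 3 n H k ->
  0 < k /\ exists col : nat -> seq nat -> 'I_k, separating n H col.
Proof.
move=> /allP uH n_gt2 [f [f_lt f_rb]].
have n_gt0 : 0 < n by lia.
pose v0 : 'I_n := Ordinal n_gt0.
pose v i : 'I_n := insubd v0 i.
have vK i : i < n -> val (v i) = i by move=> lt_in; rewrite val_insubd lt_in.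
have v_inj i j : i < n -> j < n -> v i = v j -> i = j.
  by move=> lt_in lt_jn /(congr1 val); rewrite !vK.
have v_card e : uniq e -> all (gtn n) e -> #|[set:: map v e]| = size e.
  move=> ue /allP lte; rewrite cardsE -(size_map v); apply/card_uniqP.
  by rewrite map_inj_in_uniq // => i j /lte + /lte +; apply: v_inj.
have k_gt0 : 0 < k.
  apply: leq_ltn_trans (f_lt v0 [set:: map v [:: 0; 1; 2]] _) => //.
  by rewrite v_card //=; apply/and4P; split => //; lia.
split=> //; case: k k_gt0 f_lt f_rb => // k _ f_lt f_rb.
(* Only 3-sets are known to have a color in range; on other lists [inord] may return its default,
   but edges of a copy are 3-sets. *)
exists (fun u e => inord (f (v u) [set:: map v e])); split.
  move=> u e e' eq_ee'; congr (inord (f _ _)); apply/setP=> x; rewrite !inE.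
  by apply/mapP/mapP => -[y ye ->]; exists y; rewrite // ?eq_ee' // -eq_ee'.
move=> s us /allP lts szs.
have ltn_s i : i < hv H -> nth 0 s i < n.
  by move=> lti; apply: lts; rewrite mem_nth // szs.
have phi_emb : embedding H (fun i => v (nth 0 s i)).
  move=> i j lti ltj /v_inj eq_ij; apply/eqP.
  by rewrite -(nth_uniq 0 _ _ us) ?szs // eq_ij ?ltn_s.
have [u [i lti ->] inj_u] := f_rb _ phi_emb.
have cardE e : e \in hedges H ->
    #|[set:: map v (map (nth 0 s) e)]| = 3 /\ {in e, forall a, a < hv H}.
  move=> /uH /and3P [/eqP sze ue /allP lte]; split=> //.
  rewrite v_card ?size_map //.
    rewrite map_inj_in_uniq // => a b /lte lta /lte ltb /eqP.
    by rewrite nth_uniq ?szs // => /eqP.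
  by apply/allP => _ /mapP [a /lte lta ->]; apply: ltn_s.
have copyE e : e \in hedges H ->
    [set:: map v (map (nth 0 s) e)] \in copy_edges H (fun i => v (nth 0 s i)).
  by move=> eH; apply/mapP; exists e => //; rewrite -map_comp.
move=> /(_ (nth 0 s i)) [|e [e' [eH e'H /negP not_sub]]].
  by rewrite mem_nth // szs.
move=> /(congr1 val); rewrite /= !inordK; last first.
- by apply: f_lt; have [] := cardE _ eH.
- by apply: f_lt; have [] := cardE _ e'H.
move=> /(inj_u _ _ (copyE _ eH) (copyE _ e'H)) /setP eq_set.
apply: not_sub; apply/allP => a ae.
have := eq_set (v (nth 0 s a)); rewrite !inE (map_f v (map_f _ ae)).
move=> /esym /mapP [_ /mapP [b be' ->]] eq_ab.
have [[_ lte] [_ lte']] := (cardE _ eH, cardE _ e'H).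
by rewrite (phi_emb a b (lte _ ae) (lte' _ be') eq_ab).
Qed.

(** * Cauchy-Schwarz and pigeonhole *)

(** Cauchy-Schwarz against the constant 1: sum [2 * (a i * a j) <= a i ^ 2 + a j ^ 2] over all [i]
    and [j]. *)
Lemma sum_sqr_le (I : finType) (a : I -> nat) :
  (\sum_i a i) ^ 2 <= #|I| * \sum_i a i ^ 2.
Proof.
have twice : 2 * (\sum_i a i) ^ 2 <= 2 * (#|I| * \sum_i a i ^ 2).
  have -> : 2 * (#|I| * \sum_i a i ^ 2) = \sum_i \sum_j (a i ^ 2 + a j ^ 2).
    under [RHS]eq_bigr do rewrite big_split sum_nat_const /=.
    by rewrite big_split /= sum_nat_const -big_distrr /= mul2n addnn.
  rewrite -mulnn big_distrlr big_distrr /=; apply: leq_sum => i _.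
  by rewrite big_distrr /=; apply: leq_sum => j _; rewrite nat_Cauchy.
by move: twice; rewrite leq_pmul2l.
Qed.

(** Cauchy-Schwarz over the fibers of [g]: the squared weight of a fiber is the weight of the
    couples inside it. *)
Lemma sum_collisions (I K : finType) (g : I -> K) (a : I -> nat) :
  (\sum_i a i) ^ 2 <= #|K| * \sum_i \sum_j a i * a j * (g i == g j).
Proof.
have split_a : \sum_i a i = \sum_c \sum_i a i * (g i == c).
  rewrite exchange_big /=; apply: eq_bigr => i _.
  rewrite (bigD1 (g i)) //= eqxx muln1 big1 ?addn0 // => c ne_c.
  by rewrite eq_sym (negPf ne_c) muln0.
rewrite split_a; apply: leq_trans (sum_sqr_le _) _.
rewrite leq_mul2l; apply/orP; right.
have -> : \sum_i \sum_j a i * a j * (g i == g j) =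
    \sum_c \sum_i \sum_j a i * (g i == c) * (a j * (g j == c)).
  rewrite [RHS]exchange_big /=; apply: eq_bigr => i _.
  rewrite [RHS]exchange_big /=; apply: eq_bigr => j _.
  rewrite (bigD1 (g i)) //= eqxx muln1 big1 ?addn0; last first.
    by move=> c ne_c; rewrite (eq_sym (g i)) (negPf ne_c) !muln0.
  by rewrite mulnA eq_sym.
by apply: leq_sum => c _; rewrite -mulnn big_distrlr.
Qed.

Lemma pigeonhole (I K : finType) (g : I -> K) (A : {set I}) :
  #|K| < #|A| -> exists x y, [/\ x \in A, y \in A, x != y & g x = g y].
Proof.
move=> lt_KA; have /injectivePn : ~~ injectiveb (fun z : {x | x \in A} => g (val z)).
  apply: contraL lt_KA => /injectiveP /leq_card.
  by rewrite card_sig -leqNgt.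
case=> -[x xA] [[y yA] ne_xy eq_g]; exists x, y; split=> //.
Qed.

(** * The path with three edges *)

Lemma separating_rot (n : nat) (H : hgraph) (K : finType)
    (col : nat -> seq nat -> K) (u a b z : nat) :
  separating n H col -> col u [:: z; a; b] = col u [:: a; b; z].
Proof. by case=> col_eq _; apply: col_eq => t; rewrite !inE orbC orbA. Qed.

(** The first summand pays for the vertices of the pairs, the power counts the possible values of
    [G]. *)
Lemma SP3_bound (n k : nat) (col : nat -> seq nat -> 'I_k) :
  separating n SP3 col ->
  n <= 2 * (k * k).+1 + (k * k) ^ ((k * k).+1 * (k * k).+1).
Proof.
move=> sep; have rot u a b z := separating_rot u a b z sep.
set m := (k * k).+1; rewrite leqNgt; apply/negP => n_gt.
pose N := n - 2 * m.
have nE : n = 2 * m + N by rewrite /N; lia.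
(* The pairs are [i], [m + i] for [i < m]; the other vertices are [2 * m + z]. The color from [u] of
   pair [i] joined to [z] is [c u i z]. *)
pose c u i z := col u [:: i; m + i; 2 * m + z].
pose G (z : 'I_N) : {ffun 'I_m * 'I_m -> 'I_k * 'I_k} :=
  [ffun ij : 'I_m * 'I_m => (c ij.2 ij.1 z, c (m + ij.2) ij.1 z)].
have [|x [y [_ _ ne_xy eqG]]] := @pigeonhole _ _ G [set: 'I_N].
  by rewrite cardsT card_ffun !card_prod !card_ord; lia.
(* There is one more pair than there are couples of colors seen from [x] and [y]. *)
have [|i [j [_ _ ne_ij [eq_y eq_x]]]] := @pigeonhole _ _
    (fun i : 'I_m => (c (2 * m + y) i y, c (2 * m + x) i y)) [set: 'I_m].
  by rewrite cardsT card_prod !card_ord.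
have eqP_c (l : 'I_m) : c l i x = c l i y /\ c (m + l) i x = c (m + l) i y.
  by have := congr1 (fun h : {ffun _ -> _} => h (i, l)) eqG; rewrite !ffunE => -[].
have [[lti ltj] [ltx lty]] := ((ltn_ord i, ltn_ord j), (ltn_ord x, ltn_ord y)).
apply: (sep.2 [:: 2 * m + x; i : nat; m + i; 2 * m + y; j : nat; m + j]) => //.
- by move: ne_ij ne_xy; rewrite -!val_eqE /= !inE; lia.
- by rewrite /=; lia.
move=> u; rewrite !inE => /or4P [||| /or3P[||]] /eqP ->.
- by exists [:: 1; 2; 3], [:: 3; 4; 5]; split=> //=; rewrite (rot _ j).
- by exists [:: 0; 1; 2], [:: 1; 2; 3]; split=> //=; rewrite rot; case: (eqP_c i).
- by exists [:: 0; 1; 2], [:: 1; 2; 3]; split=> //=; rewrite rot; case: (eqP_c i).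
- by exists [:: 1; 2; 3], [:: 3; 4; 5]; split=> //=; rewrite (rot _ j).
- by exists [:: 0; 1; 2], [:: 1; 2; 3]; split=> //=; rewrite rot; case: (eqP_c j).
- by exists [:: 0; 1; 2], [:: 1; 2; 3]; split=> //=; rewrite rot; case: (eqP_c j).
Qed.

(** * Four edges, first path *)

Lemma sum_bool_card (I : finType) (P : pred I) :
  \sum_i (P i : nat) = #|[set i | P i]|.
Proof.
rewrite -sum1_card [RHS]big_mkcond /=; apply: eq_bigr => i _.
by rewrite inE; case: (P i).
Qed.

Lemma SP1_4_bound (n k : nat) (col : nat -> seq nat -> 'I_k) :
  0 < k -> separating n (SP1 4) col -> n <= 12 * k ^ 8.
Proof.
move=> k_gt0 sep; have rot u a b z := separating_rot u a b z sep.
(* The final inequality is [N * m <= m * k ^ 8 + 3 * k ^ 2 * N]. With this [m] the last term is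
   three quarters of the left side, leaving [N <= 4 * k ^ 8]. *)
have [m mE] : {m | m = 4 * k ^ 2} by exists (4 * k ^ 2).
have [n_le|n_gt] := leqP n (2 * m).
  by apply: leq_trans n_le _; rewrite mE mulnA leq_mul // leq_pexp2l.
pose N := n - 2 * m.
have nE : n = 2 * m + N by rewrite /N; lia.
pose c u i z := col u [:: i; m + i; 2 * m + z].
pose F (z : 'I_N) (i : 'I_m) := c (2 * m + z) i z.
pose S i l j := [set z | (F z i == F z l) && (F z j == F z l)].
have card_S (i l j : 'I_m) : i != l -> j != l -> i != j -> #|S i l j| <= k ^ 6.
  move=> ne_il ne_jl ne_ij; rewrite leqNgt; apply/negP => S_gt.
  have [|x [y []]] := @pigeonhole _ _ (fun z : 'I_N =>
      (c i l z, c (m + i) l z, (c l l z, c (m + l) l z),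
       (c j l z, c (m + j) l z))) (S i l j).
    by apply: leq_trans S_gt; rewrite !card_prod !card_ord !expnS expn0 muln1 !mulnA.
  rewrite !inE => /andP [/eqP xi /eqP xj] /andP [/eqP yi /eqP yj].
  move=> ne_xy [e1 e2 e3 e4 e5 e6].
  have [[lti ltj] ltl] := ((ltn_ord i, ltn_ord j), ltn_ord l).
  have [ltx lty] := (ltn_ord x, ltn_ord y).
  apply: (sep.2 [:: i : nat; m + i; 2 * m + x; l : nat; m + l; 2 * m + y;
                    j : nat; m + j]) => //.
  - move: ne_xy ne_il ne_jl ne_ij lti ltj ltl; clear.
    rewrite -!val_eqE /= !inE !negb_or => *; do ?[apply/andP; split=> //]; lia.
  - by rewrite /=; lia.
  (* The two middle edges serve all six vertices of the pairs; membership in [S i l j] serves [x]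
     and [y]. *)
  have BC u : c u l x = c u l y ->
      served (SP1 4) col [:: i : nat; m + i; 2 * m + x; l : nat; m + l;
                             2 * m + y; j : nat; m + j] u.
    by move=> eq_u; exists [:: 2; 3; 4], [:: 3; 4; 5]; split; rewrite //= rot.
  move=> u; rewrite !inE => /or4P [|||/or4P [|||/orP []]] /eqP ->;
    try exact: BC.
    by exists [:: 0; 1; 2], [:: 2; 3; 4]; split; rewrite //= (rot _ l).
  by exists [:: 3; 4; 5], [:: 5; 6; 7]; split; rewrite //= (rot _ j).
(* [T z] counts the triples of pairs, repetitions allowed, that get a single color at [z] from
   [z]. *)
pose T z := \sum_l (\sum_i ((F z i == F z l) : nat)) ^ 2.
(* With [d] the number of couples of pairs of equal color, [m ^ 2 <= k * d] and
   [d ^ 2 <= m * T z]. *)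
have T_ge z : m ^ 3 <= k ^ 2 * T z.
  have := sum_collisions (F z) (fun=> 1).
  have := sum_sqr_le (fun l => \sum_i ((F z i == F z l) : nat)).
  rewrite -/(T z) sum1_card !card_ord exchange_big /=.
  set d := \sum_j _; set d' := \sum_i \sum_j _.
  have -> : d' = d.
    by apply: eq_bigr => i _; apply: eq_bigr => j _; rewrite !mul1n.
  move=> le1 le2.
  have m_gt0 : 0 < m by rewrite mE; lia.
  rewrite -(leq_pmul2l m_gt0) -expnS (@leq_trans ((k * d) ^ 2)) //.
    by rewrite (expnM m 2 2) leq_exp2r.
  by rewrite expnMn mulnCA leq_mul2l le1 orbT.
(* Triples of distinct pairs contribute at most [k ^ 6] each; those with a repetition number at most
   [3 * m ^ 2] and contribute at most [N] each. *)
have T_le : \sum_z T z <= m ^ 3 * k ^ 6 + 3 * m ^ 2 * N.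
  have -> : \sum_z T z = \sum_l \sum_i \sum_j #|S i l j|.
    rewrite exchange_big /=; apply: eq_bigr => l _.
    under eq_bigr do rewrite -mulnn big_distrlr /=.
    rewrite exchange_big /=; apply: eq_bigr => i _.
    rewrite exchange_big /=; apply: eq_bigr => j _.
    by under eq_bigr do rewrite mulnb; rewrite sum_bool_card.
  apply: (@leq_trans (\sum_(l < m) \sum_(i < m) \sum_(j < m)
      (k ^ 6 + N * ((i == l) + (j == l) + (i == j))))).
    apply: leq_sum => l _; apply: leq_sum => i _; apply: leq_sum => j _.
    have S_max : #|S i l j| <= N by rewrite -[leqRHS]card_ord max_card.
    case E : [|| i == l, j == l | i == j].
      apply: leq_trans S_max (leq_trans _ (leq_addl _ _)).
      by move: E; case: (i == l); case: (j == l); case: (i == j) => //= _;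
        rewrite leq_pmulr.
    apply: leq_trans (leq_addr _ _); move/negbT: E.
    by rewrite !negb_or => /and3P [ne_il ne_jl ne_ij]; apply: card_S.
  have one (x : 'I_m) : \sum_(i < m) (i == x) = 1.
    by rewrite (bigD1 x) //= eqxx big1 // => i /negPf ->.
  have one' (x : 'I_m) : \sum_(i < m) (x == i) = 1.
    by rewrite -(one x); apply: eq_bigr => i _; rewrite eq_sym.
  under eq_bigr => l _.
    under eq_bigr => i _.
      rewrite big_split /= sum_nat_const card_ord -big_distrr /= 2!big_split /=.
      rewrite sum_nat_const card_ord one one'.
      over.
    rewrite big_split /= sum_nat_const card_ord -big_distrr /= !big_split /=.
    rewrite -big_distrr /= one !sum_nat_const !card_ord.
    over.
  rewrite sum_nat_const card_ord !expnS expn0; nia.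
have : N * m ^ 3 <= k ^ 2 * (m ^ 3 * k ^ 6 + 3 * m ^ 2 * N).
  apply: leq_trans (leq_mul (leqnn _) T_le).
  rewrite big_distrr /= -[X in X * _]card_ord -sum_nat_const.
  by apply: leq_sum => z _; apply: T_ge.
have -> : k ^ 2 * (m ^ 3 * k ^ 6 + 3 * m ^ 2 * N) =
          m ^ 2 * (m * k ^ 8 + 3 * k ^ 2 * N).
  by rewrite !expnS !expn0; lia.
rewrite (expnSr m 2) mulnCA leq_pmul2l mE ?expn_gt0 ?muln_gt0 ?expn_gt0 ?k_gt0 //.
have k2 : 0 < k ^ 2 by rewrite expn_gt0 k_gt0.
have k8 : k ^ 8 = k ^ 2 * k ^ 6 by rewrite -expnD.
have k6 : 0 < k ^ 6 by rewrite expn_gt0 k_gt0.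
move=> le_N.
have : N <= 4 * k ^ 8 by nia.
rewrite nE mE; nia.
Qed.

(** * Four edges, second path *)

Lemma SP2_4_bound (n k : nat) (col : nat -> seq nat -> 'I_k) :
  0 < k -> separating n (SP2 4) col -> n <= 8 * k ^ 6.
Proof.
move=> k_gt0 sep; have rot u a b z := separating_rot u a b z sep.
(* In the final inequality [N * m <= k ^ 6 * (2 * m + N)] this makes the [N] term on the right half
   of the left side. *)
have [m mE] : {m | m = 2 * k ^ 6} by exists (2 * k ^ 6).
have [n_le|n_gt] := leqP n (2 * m).
  by apply: leq_trans n_le _; rewrite mE mulnA leq_mul.
pose N := n - 2 * m.
have nE : n = 2 * m + N by rewrite /N; lia.
pose c u i z := col u [:: i; m + i; 2 * m + z].
pose h (i : 'I_m) (z : 'I_N) := (c i i z, c (m + i) i z).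
pose G (x y : 'I_N) (i : 'I_m) := (c (2 * m + y) i y, c (2 * m + x) i y).
pose S y i j :=
  [set x | (h i x == h i y) && (h j x == h j y) && (G x y i == G x y j)].
(* The bound is 2 and not 1 because [y] itself may lie in [S y i j], while [x] and [z] must both
   differ from it. *)
have card_S (y : 'I_N) (i j : 'I_m) : i != j -> #|S y i j| <= 2.
  move=> ne_ij; rewrite leqNgt; apply/negP => S_gt.
  have /card_gt1P [x [z []]] : 1 < #|S y i j :\ y|.
    by move: S_gt; rewrite (cardsD1 y (S y i j)); case: (y \in _); lia.
  rewrite !inE => /andP [ne_xy /andP [/andP [/eqP [xi xi'] _] /eqP [yij xij]]].
  move=> /andP [ne_zy /andP [/andP [_ /eqP [zj zj']] /eqP [_ zij]]] ne_xz.
  have [lti ltj] := (ltn_ord i, ltn_ord j).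
  have [[ltx lty] ltz] := ((ltn_ord x, ltn_ord y), ltn_ord z).
  apply: (sep.2 [:: 2 * m + x; i : nat; m + i; 2 * m + y; j : nat; m + j;
                    2 * m + z]) => //.
  - move: ne_xy ne_zy ne_xz ne_ij lti ltj; clear.
    rewrite -!val_eqE /= !inE !negb_or => *; do ?[apply/andP; split=> //]; lia.
  - by rewrite /=; lia.
  move=> u; rewrite !inE => /or4P [|||/or4P [|||]] /eqP ->.
  - by exists [:: 1; 2; 3], [:: 3; 4; 5]; split; rewrite //= (rot _ j).
  - by exists [:: 0; 1; 2], [:: 1; 2; 3]; split; rewrite //= rot.
  - by exists [:: 0; 1; 2], [:: 1; 2; 3]; split; rewrite //= rot.
  - by exists [:: 1; 2; 3], [:: 3; 4; 5]; split; rewrite //= (rot _ j).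
  - by exists [:: 3; 4; 5], [:: 4; 5; 6]; split; rewrite //= rot.
  - by exists [:: 3; 4; 5], [:: 4; 5; 6]; split; rewrite //= rot.
  - by exists [:: 1; 2; 3], [:: 3; 4; 5]; split; rewrite //= (rot _ j).
(* [I y x] counts the pairs not distinguishing [x] from [y]; [R y x] counts the couples of such
   pairs that [x] and [y] do not distinguish at [y]. Cauchy-Schwarz is applied over the values of
   [G], of [h], and over the couples [(y, x)]. *)
pose I (y x : 'I_N) := \sum_i ((h i x == h i y) : nat).
pose R (y x : 'I_N) :=
  \sum_i \sum_j (h i x == h i y) * (h j x == h j y) * (G x y i == G x y j).
have I_R y x : I y x ^ 2 <= k ^ 2 * R y x.
  have := sum_collisions (G x y) (fun i => (h i x == h i y) : nat).
  by rewrite card_prod card_ord mulnn.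
have sum_I : m * N ^ 2 <= k ^ 2 * \sum_y \sum_x I y x.
  have -> : \sum_y \sum_x I y x = \sum_i \sum_y \sum_x ((h i y == h i x) : nat).
    rewrite [RHS]exchange_big /=; apply: eq_bigr => y _.
    rewrite [RHS]exchange_big /=; apply: eq_bigr => x _.
    by apply: eq_bigr => i _; rewrite eq_sym.
  rewrite -[X in X * _]card_ord -sum_nat_const big_distrr /=.
  apply: leq_sum => i _.
  have := sum_collisions (h i) (fun=> 1).
  rewrite sum1_card card_prod !card_ord mulnn => le_h; apply: leq_trans le_h _.
  by rewrite leq_mul2l; apply/orP; right; do 2!apply: leq_sum => ? _; rewrite !mul1n.
have sum_R : (\sum_y \sum_x I y x) ^ 2 <= N ^ 2 * (k ^ 2 * \sum_y \sum_x R y x).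
  rewrite (pair_bigA _ I) (pair_bigA _ R) /=; apply: leq_trans (sum_sqr_le _) _.
  rewrite card_prod !card_ord mulnn leq_mul2l big_distrr /=.
  by apply/orP; right; apply: leq_sum => -[y x] _; apply: I_R.
(* Couples [i != j] fall under [card_S]; each of the [m] diagonal ones costs at most [N]. *)
have R_le : \sum_y \sum_x R y x <= N * (2 * m ^ 2 + N * m).
  have -> : \sum_y \sum_x R y x = \sum_y \sum_i \sum_j #|S y i j|.
    apply: eq_bigr => y _; rewrite exchange_big /=; apply: eq_bigr => i _.
    rewrite exchange_big /=; apply: eq_bigr => j _.
    by under eq_bigr do rewrite !mulnb; rewrite sum_bool_card.
  rewrite -[X in X * _]card_ord -sum_nat_const; apply: leq_sum => y _.
  apply: (@leq_trans (\sum_(i < m) \sum_(j < m) (2 + N * (i == j)))).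
    apply: leq_sum => i _; apply: leq_sum => j _.
    have [_|/card_S/leq_trans] := eqVneq i j; last by apply; rewrite leq_addr.
    by rewrite muln1 (leq_trans (max_card _)) // card_ord leq_addl.
  under eq_bigr => i _.
    rewrite big_split /= sum_nat_const card_ord -big_distrr /=.
    rewrite (bigD1 i) //= eqxx big1 ?addn0 ?muln1; last first.
      by move=> j; rewrite eq_sym => /negPf ->.
    over.
  by rewrite sum_nat_const card_ord mulnDr -mulnn; lia.
have N_gt0 : 0 < N by rewrite /N; lia.
have m_gt0 : 0 < m by rewrite mE muln_gt0 expn_gt0 k_gt0.
have : N ^ 2 * (N * m) * (N * m) <= N ^ 2 * (N * m) * (k ^ 6 * (2 * m + N)).
  have -> : N ^ 2 * (N * m) * (N * m) = (m * N ^ 2) ^ 2 by rewrite !expnS expn0; lia.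
  apply: (@leq_trans ((k ^ 2 * \sum_y \sum_x I y x) ^ 2)); first by rewrite leq_exp2r.
  rewrite expnMn; apply: leq_trans (leq_mul (leqnn _) sum_R) _.
  have -> : N ^ 2 * (N * m) * (k ^ 6 * (2 * m + N)) =
      (k ^ 2) ^ 2 * (N ^ 2 * (k ^ 2 * (N * (2 * m ^ 2 + N * m)))).
    by rewrite !expnS !expn0; lia.
  by rewrite !leq_mul2l R_le !orbT.
rewrite leq_pmul2l ?muln_gt0 ?expn_gt0 ?N_gt0 ?m_gt0 //.
have k6 : 0 < k ^ 6 by rewrite expn_gt0 k_gt0.
move=> le_N; have : N <= 4 * k ^ 6 by nia.
rewrite nE mE; nia.
Qed.

(** * Bowties and the common configuration for five or more edges *)

(* Otherwise every triple of [F] is the only triple of [F] through one of its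
   three coordinates. *)
Lemma sharing_one_coordinate (s : nat) (F : {set 'I_s * 'I_s * 'I_s}) :
  3 * s < #|F| ->
  exists e e', [/\ e \in F, e' \in F &
    (e.1.1 == e'.1.1) + (e.1.2 == e'.1.2) + (e.2 == e'.2) = 1].
Proof.
move=> F_gt; pose T := ('I_s * 'I_s * 'I_s)%type.
pose share (e e' : T) :=
  (e.1.1 == e'.1.1) + (e.1.2 == e'.1.2) + (e.2 == e'.2) == 1.
have [/existsP [e /existsP [e' /and3P [eF e'F /eqP ee']]]|no_share] :=
  boolP [exists e, exists e', [&& e \in F, e' \in F & share e e']].
  by exists e, e'.
have{no_share} shareF e e' : e \in F -> e' \in F -> ~~ share e e'.
  move=> eF e'F; apply: contra no_share => ee'.
  by apply/existsP; exists e; apply/existsP; exists e'; rewrite eF e'F.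
pose alone (pr : T -> 'I_s) :=
  [set e in F | [forall (e' | e' \in F), (pr e' == pr e) ==> (e' == e)]].
have card_alone pr : #|alone pr| <= s.
  rewrite -[leqRHS]card_ord; rewrite -(card_in_imset (f := pr)) ?max_card //.
  move=> e e'; rewrite !inE => /andP [eF _] /andP [_ /forall_inP /(_ e eF)].
  by move=> /implyP alone_e /eqP /alone_e /eqP.
have not_alone (pr : T -> 'I_s) e : e \in F -> e \notin alone pr ->
    exists e', [/\ e' \in F, pr e' = pr e & e' != e].
  move=> eF; rewrite inE eF /= negb_forall => /existsP [e'].
  by rewrite !negb_imply => /and3P [e'F /eqP eq_pr ne]; exists e'.
pose pr1 (e : T) := e.1.1; pose pr2 (e : T) := e.1.2; pose pr3 (e : T) := e.2.
have : F \subset alone pr1 :|: alone pr2 :|: alone pr3.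
  apply/subsetP => e eF; rewrite 2!in_setU; apply: contraT; rewrite !negb_or.
  case/andP => /andP [/not_alone - /(_ eF) [e1 [e1F eq1 ne1]]].
  move=> /not_alone - /(_ eF) [e2 [e2F eq2 ne2]].
  move=> /not_alone - /(_ eF) [e3 [e3F eq3 ne3]].
  (* Each of [e1], [e2], [e3] shares exactly two coordinates with [e]. They cannot all differ from
     [e] in the same coordinate, and two that differ from it in different ones share exactly one
     coordinate with each other. *)
  have := shareF _ _ e1F eF; have := shareF _ _ e2F eF.
  have := shareF _ _ e3F eF; have := shareF _ _ e1F e2F.
  have := shareF _ _ e1F e3F; have := shareF _ _ e2F e3F.
  move: e e1 e2 e3 {eF e1F e2F e3F} eq1 eq2 eq3 ne1 ne2 ne3.
  move=> [[a b] c] [[a1 b1] c1] [[a2 b2] c2] [[a3 b3] c3].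
  rewrite /pr1 /pr2 /pr3 /share /= => -> -> ->; rewrite !xpair_eqE !eqxx /=.
  have [?|?] := eqVneq b1 b; have [?|?] := eqVneq c1 c => //=;
  have [?|?] := eqVneq a2 a; have [?|?] := eqVneq c2 c => //=;
  have [?|?] := eqVneq a3 a; have [?|?] := eqVneq b3 b => //=;
  subst; rewrite ?eqxx //=;
  repeat match goal with ne : is_true (?x != ?y) |- _ =>
    rewrite ?(eq_sym y x) ?(negPf ne) //=; clear ne end.
move=> /subset_leq_card; rewrite leqNgt => /negP []; apply: leq_ltn_trans _ F_gt.
rewrite [leqRHS](_ : _ = s + s + s); last by lia.
apply: leq_trans (leq_card_setU _ _) (leq_add _ (card_alone _)).
exact: leq_trans (leq_card_setU _ _) (leq_add (card_alone _) (card_alone _)).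
Qed.

(** Cut [3 * s] elements of [U] into three blocks. Some color has more than [3 * s] of the [s ^ 3]
    transversal triples, so two of these agree in exactly one coordinate, which gives [v]. *)
Lemma bowtie (K : finType) (chi : seq nat -> K) (U : seq nat) (s : nat) :
  (forall e e', e =i e' -> chi e = chi e') ->
  uniq U -> 3 * s <= size U -> #|K| * (3 * s) < s ^ 3 ->
  exists v b c b' c', [/\ uniq [:: b; c; v; b'; c'],
    {subset [:: b; c; v; b'; c'] <= U} & chi [:: b; c; v] = chi [:: v; b'; c']].
Proof.
move=> chi_eq uU le_sU K_lt.
pose g (e : 'I_s * 'I_s * 'I_s) :=
  chi [:: nth 0 U e.1.1; nth 0 U (s + e.1.2); nth 0 U (2 * s + e.2)].
have [kap kap_gt] : exists kap, 3 * s < #|[set e | g e == kap]|.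
  apply/existsP; apply: contraLR K_lt; rewrite negb_exists -leqNgt => /forallP le.
  have -> : s ^ 3 = \sum_(e : 'I_s * 'I_s * 'I_s) 1.
    by rewrite sum1_card !card_prod !card_ord !expnS expn0 muln1 mulnA.
  rewrite (partition_big g predT) //= -sum_nat_const; apply: leq_sum => kap _.
  have := le kap; rewrite -leqNgt; apply: leq_trans.
  by rewrite -sum1_card; apply/eq_leq/eq_bigl => e; rewrite inE.
have [[[a b] c] [[[a' b'] c'] []]] := sharing_one_coordinate kap_gt.
rewrite !inE /g /= => /eqP <- /eqP/esym eq_chi one.
pose w i := nth 0 U i.
have w_uniq t : uniq t -> all (gtn (3 * s)) t -> uniq (map w t).
  move=> ut /allP lt; rewrite map_inj_in_uniq // => i j /lt lti /lt ltj /eqP.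
  by rewrite nth_uniq ?(leq_trans _ le_sU) // => /eqP.
have w_sub t : all (gtn (3 * s)) t -> {subset map w t <= U}.
  by move=> /allP lt _ /mapP [i /lt lti ->]; rewrite mem_nth ?(leq_trans _ le_sU).
have [[lta ltb] ltc] := ((ltn_ord a, ltn_ord b), ltn_ord c).
have [[lta' ltb'] ltc'] := ((ltn_ord a', ltn_ord b'), ltn_ord c').
have bowtie_w v t1 t2 t1' t2' : uniq [:: t1; t2; v; t1'; t2'] ->
    all (gtn (3 * s)) [:: t1; t2; v; t1'; t2'] ->
    chi [:: w t1; w t2; w v] = chi [:: w v; w t1'; w t2'] ->
    exists v b c b' c', [/\ uniq [:: b; c; v; b'; c'],
    {subset [:: b; c; v; b'; c'] <= U} & chi [:: b; c; v] = chi [:: v; b'; c']].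
  move=> ut lt eq_t; exists (w v), (w t1), (w t2), (w t1'), (w t2').
  by split; [apply: (w_uniq _ ut lt) | apply: (w_sub _ lt) |].
have rot t1 t2 t3 : chi [:: t1; t2; t3] = chi [:: t2; t3; t1].
  by apply: chi_eq => t; rewrite !inE orbC orbA.
move: one.
have [eq_a|ne_a] := eqVneq a a'; have [eq_b|ne_b] := eqVneq b b';
  have [eq_c|ne_c] := eqVneq c c' => // _.
- subst a'; apply: (bowtie_w a (s + b) (2 * s + c) (s + b') (2 * s + c')).
  + move: ne_b ne_c; rewrite -!val_eqE /= !inE; lia.
  + by rewrite /=; lia.
  + by rewrite -rot.
- subst b'; apply: (bowtie_w (s + b) (2 * s + c) a (2 * s + c') a').
  + move: ne_a ne_c; rewrite -!val_eqE /= !inE; lia.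
  + by rewrite /=; lia.
  + by rewrite -(rot (w a')) rot.
- subst c'; apply: (bowtie_w (2 * s + c) a (s + b) a' (s + b')).
  + move: ne_a ne_b; rewrite -!val_eqE /= !inE; lia.
  + by rewrite /=; lia.
  + by rewrite (rot (w (2 * s + c))).
Qed.

Lemma sum_const_ord (n c : nat) : \sum_(i < n) c = n * c.
Proof. by rewrite sum_nat_const card_ord. Qed.

(* The edges [x; p; p'] and [p; p'; y] serve all vertices except their own four,
   which are served by the bowtie [b; c; v], [v; b'; c']. *)
Lemma served_configuration (n k r : nat) (col : nat -> seq nat -> 'I_k) :
  0 < k -> (forall u e e', e =i e' -> col u e = col u e') ->
  (16 + 2 * r) * k ^ 3 < n ->
  exists p p' x y v b c b' c' rest,
    [/\ uniq ([:: p; p'; x; y; b; c; v; b'; c'] ++ rest),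
        all (gtn n) ([:: p; p'; x; y; b; c; v; b'; c'] ++ rest),
        size rest = r,
        {in [:: p; p'; x; y], forall u, col u [:: b; c; v] = col u [:: v; b'; c']} &
        {in [:: b; c; v; b'; c'] ++ rest, forall u,
          col u [:: x; p; p'] = col u [:: p; p'; y]}].
Proof.
move=> k_gt0 col_eq n_gt; have rot u a b z : col u [:: z; a; b] = col u [:: a; b; z].
  by apply: col_eq => t; rewrite !inE orbC orbA.
have [m mE] : {m | m = 2 * k} by exists (2 * k).
pose N := n - (2 + m).
have k3 : k <= k ^ 3 by rewrite -[leqLHS]expn1 leq_pexp2l.
have nE : n = 2 + m + N by rewrite /N mE; nia.
(* [6 * k ^ 2] is what [bowtie] needs for [s = 2 * k ^ 2]; beyond its five vertices at least [r]
   remain. In the hypothesis on [n], 12 of the 16 comes from [2 * k * B], and the other [4 * k ^ 3]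
   covers the [2 + 2 * k] vertices set aside. *)
pose B := 6 * k ^ 2 + r.
have N_gt : 2 * k * B < N.
  have kB : 2 * k * B = 12 * k ^ 3 + 2 * k * r by rewrite /B !expnS expn0; lia.
  by rewrite kB /N mE; nia.
pose F (z : 'I_N) (i : 'I_m) := col (2 + m + z) [:: 0; 1; 2 + i].
have [i [j [ne_ij]]] : exists i j, i != j /\ B < #|[set z | F z i == F z j]|.
  (* Otherwise, count the triples [(z, i, j)] with [F z i = F z j]: there are at least
     [N * m ^ 2 / k], and at most [m * (m * B + N)]. For [m = 2 * k] this forces
     [N <= 2 * k * B]. *)
  case: (boolP [exists i, exists j, (i != j) && (B < #|[set z | F z i == F z j]|)]).
    by move=> /existsP [i /existsP [j /andP [ne lt]]]; exists i, j.
  rewrite negb_exists => /forallP no_ij.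
  have le_ij i j : i != j -> #|[set z | F z i == F z j]| <= B.
    move=> ne; have := no_ij i; rewrite negb_exists => /forallP /(_ j).
    by rewrite ne -leqNgt.
  have le_N : N * m ^ 2 <= k * (m * (m * B + N)).
    apply: (@leq_trans (k * \sum_i \sum_j #|[set z | F z i == F z j]|)).
      rewrite -sum_const_ord.
      have -> : \sum_i \sum_j #|[set z | F z i == F z j]| =
          \sum_z \sum_i \sum_j ((F z i == F z j) : nat).
        rewrite [RHS]exchange_big /=; apply: eq_bigr => i _.
        rewrite [RHS]exchange_big /=; apply: eq_bigr => j _.
        by rewrite sum_bool_card.
      rewrite big_distrr /=; apply: leq_sum => z _.
      have := sum_collisions (F z) (fun=> 1); rewrite sum1_card !card_ord.
      move/leq_trans; apply; rewrite leq_mul2l; apply/orP; right.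
      by do 2!apply: leq_sum => ? _; rewrite !mul1n.
    rewrite leq_mul2l; apply/orP; right.
    rewrite -sum_const_ord; apply: leq_sum => i _.
    rewrite (bigD1 i) //= addnC leq_add //; last first.
      by rewrite -[leqRHS]card_ord max_card.
    rewrite -(sum_const_ord m B) [leqRHS](bigD1 i) //=.
    by apply: leq_trans (leq_addl _ _); apply: leq_sum => j ne; rewrite le_ij // eq_sym.
  suff : N <= 2 * k * B by rewrite leqNgt N_gt.
  have k2_gt0 : 0 < 2 * k ^ 2 by rewrite muln_gt0 expn_gt0 k_gt0.
  rewrite -(leq_pmul2l k2_gt0); move: le_N; rewrite {}mE !expnS !expn0; lia.
set V := [set z | _] => V_gt.
pose U := [seq 2 + m + val z | z <- enum V].
have U_size : size U = #|V| by rewrite size_map -cardE.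
have U_uniq : uniq U.
  by rewrite map_inj_uniq ?enum_uniq // => z z' /addnI /val_inj.
have U_ge u : u \in U -> 2 + m <= u < n.
  by case/mapP => z _ ->; have /= := ltn_ord z; rewrite /N; lia.
have U_served u : u \in U -> col u [:: 2 + i; 0; 1] = col u [:: 0; 1; 2 + j].
  by case/mapP => z; rewrite mem_enum inE => /eqP eqF ->; rewrite rot.
(* The color is the quadruple seen from the four vertices of the two edges; [k ^ 4 * (6 * k ^ 2)] is
   less than [(2 * k ^ 2) ^ 3]. *)
have [||||v [b [c [b' [c' [u5 sub5 /= eq_chi]]]]]] :=
  @bowtie _ (fun e => (col 0 e, col 1 e, (col (2 + i) e, col (2 + j) e))) U (2 * k ^ 2).
- by move=> e e' eq_e; congr (_, _, (_, _)); apply: col_eq.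
- exact: U_uniq.
- by rewrite U_size; move: V_gt; rewrite /B; lia.
- rewrite !card_prod !card_ord !expnS !expn0; nia.
case: eq_chi => eq0 eq1 eq2 eq3.
pose t := [:: b; c; v; b'; c'].
pose W := [seq u <- U | u \notin t].
have W_size : r <= size W.
  have : size [seq u <- U | u \in t] <= size t.
    apply: uniq_leq_size; first by rewrite filter_uniq.
    by move=> u; rewrite mem_filter => /andP [].
  have : size [seq u <- U | u \in t] + size W = #|V|.
    by rewrite -U_size !size_filter; apply: (count_predC (mem t)).
  have : 0 < k ^ 2 by rewrite expn_gt0 k_gt0.
  by move: V_gt; rewrite /B /=; lia.
have sub_rest : {subset t ++ take r W <= U}.
  move=> u; rewrite mem_cat => /orP [/sub5 //|/mem_take].
  by rewrite mem_filter => /andP [].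
have rest_uniq : uniq (t ++ take r W).
  rewrite cat_uniq u5 take_uniq ?filter_uniq // andbT; apply/hasPn => u /mem_take.
  by rewrite mem_filter => /andP [].
have [lti ltj] := (ltn_ord i, ltn_ord j).
exists 0, 1, (2 + i), (2 + j), v, b, c, b', c', (take r W); split.
- change (uniq ([:: 0; 1; 2 + i; 2 + j] ++ (t ++ take r W))).
  rewrite cat_uniq rest_uniq andbT; apply/andP; split.
    by move: ne_ij; rewrite -val_eqE /= !inE; lia.
  by apply/hasPn => u /sub_rest /U_ge; rewrite !inE; lia.
- change (all (gtn n) ([:: 0; 1; 2 + i; 2 + j] ++ (t ++ take r W))).
  rewrite all_cat; apply/andP; split; first by rewrite /=; lia.
  by apply/allP => u /sub_rest /U_ge /andP [].
- by rewrite size_takel.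
- by move=> u; rewrite !inE => /or4P [] /eqP ->.
- by move=> u /sub_rest; apply: U_served.
Qed.

(** * Paths with at least five edges *)

Lemma three_uniform_SP_of (s : nat -> nat) (t : nat) :
  {homo s : i j / i <= j} -> three_uniform (SP_of s t).
Proof.
move=> s_homo; apply/allP => e /mapP [i]; rewrite mem_iota add0n => /andP [_ lt_it] ->.
have le_i : s i <= s t.-1 by apply: s_homo; lia.
by rewrite /= !inE; lia.
Qed.

Lemma sp1_s_homo : {homo sp1_s : i j / i <= j}.
Proof. by apply: homo_leq leq_trans _ => // i; rewrite leq_addr. Qed.

Lemma sp2_s_homo : {homo sp2_s : i j / i <= j}.
Proof. by apply: homo_leq leq_trans _ => // i; rewrite leq_addr. Qed.

Lemma mem_SP_of (s : nat -> nat) (t i : nat) :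
  i < t -> [:: s i; (s i).+1; (s i).+2] \in hedges (SP_of s t).
Proof. by move=> lt_it; apply/mapP; exists i; rewrite // mem_iota. Qed.

(** Counting edges from 0, edges 0 and 1 meet in one vertex and form the bowtie, while edges 3 and 4
    share the pair [p], [p']. These four use the nine vertices present at [t = 5]. *)
Lemma SP1_bound (n k t : nat) (col : nat -> seq nat -> 'I_k) :
  0 < k -> 5 <= t -> separating n (SP1 t) col -> n <= (16 + 2 * hv (SP1 t)) * k ^ 3.
Proof.
move=> k_gt0 t_ge5 [col_eq sep]; rewrite leqNgt; apply/negP => n_gt.
have hv_ge : 9 <= hv (SP1 t).
  by apply: (leq_add (@sp1_s_homo 4 _ _) (leqnn 3)); lia.
have [|p [p' [x [y [v [b [c [b' [c' [r [ur ltr szr own rest]]]]]]]]]]] :=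
    @served_configuration n k (hv (SP1 t) - 9) col k_gt0 col_eq.
  apply: leq_ltn_trans n_gt; rewrite leq_mul2r; lia.
have perm_s : perm_eq ([:: b; c; v; b'; c'; x; p; p'; y] ++ r)
                      ([:: p; p'; x; y; b; c; v; b'; c'] ++ r).
  by apply/permP => q; rewrite !count_cat /=; lia.
have edge i := @mem_SP_of sp1_s t i.
apply: (sep ([:: b; c; v; b'; c'; x; p; p'; y] ++ r)).
- by rewrite (perm_uniq perm_s).
- by rewrite (perm_all _ perm_s).
- by rewrite size_cat szr; apply: subnKC.
move=> u; rewrite (perm_mem perm_s) (@mem_cat _ u [:: p; p'; x; y] (_ :: _)).
case/orP => [/own|/rest] eq_u.
  exists [:: 0; 1; 2], [:: 2; 3; 4]; split=> //.
  - by apply: (edge 0); lia.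
  - by apply: (edge 1); lia.
exists [:: 5; 6; 7], [:: 6; 7; 8]; split=> //.
- by apply: (edge 3); lia.
- by apply: (edge 4); lia.
Qed.

(** Here the roles are exchanged: edges 0 and 1 share the pair, edges 3 and 4 form the bowtie. *)
Lemma SP2_bound (n k t : nat) (col : nat -> seq nat -> 'I_k) :
  0 < k -> 5 <= t -> separating n (SP2 t) col -> n <= (16 + 2 * hv (SP2 t)) * k ^ 3.
Proof.
move=> k_gt0 t_ge5 [col_eq sep]; rewrite leqNgt; apply/negP => n_gt.
have hv_ge : 9 <= hv (SP2 t).
  by apply: (leq_add (@sp2_s_homo 4 _ _) (leqnn 3)); lia.
have [|p [p' [x [y [v [b [c [b' [c' [r [ur ltr szr own rest]]]]]]]]]]] :=
    @served_configuration n k (hv (SP2 t) - 9) col k_gt0 col_eq.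
  apply: leq_ltn_trans n_gt; rewrite leq_mul2r; lia.
have perm_s : perm_eq ([:: x; p; p'; y; b; c; v; b'; c'] ++ r)
                      ([:: p; p'; x; y; b; c; v; b'; c'] ++ r).
  by apply/permP => q; rewrite !count_cat /=; lia.
have edge i := @mem_SP_of sp2_s t i.
apply: (sep ([:: x; p; p'; y; b; c; v; b'; c'] ++ r)).
- by rewrite (perm_uniq perm_s).
- by rewrite (perm_all _ perm_s).
- by rewrite size_cat szr; apply: subnKC.
move=> u; rewrite (perm_mem perm_s) (@mem_cat _ u [:: p; p'; x; y] (_ :: _)).
case/orP => [/own|/rest] eq_u.
  exists [:: 4; 5; 6], [:: 6; 7; 8]; split=> //.
  - by apply: (edge 3); lia.
  - by apply: (edge 4); lia.
exists [:: 0; 1; 2], [:: 1; 2; 3]; split=> //.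
- by apply: (edge 0); lia.
- by apply: (edge 1); lia.
Qed.

(** * From bounds on n to asymptotic lower bounds *)

Lemma INR_expn (k d : nat) : INR (k ^ d) = (INR k ^ d)%R.
Proof. by elim: d => [|d IHd]; rewrite ?expn0 // expnS mult_INR IHd. Qed.

Lemma big_Omega_of_bound (H : hgraph) (g : nat -> R) (a : R) (d C N : nat) :
  0 < d -> (a * INR d = 1)%R -> three_uniform H ->
  (forall n, N <= n -> (0 < g n)%R) ->
  (forall n k (col : nat -> seq nat -> 'I_k), N <= n -> 0 < k ->
     separating n H col -> (g n <= INR C * INR k ^ d)%R) ->
  big_Omega 3 H (fun n => Rpower (g n) a).
Proof.
move=> d_gt0 ad uH g_gt0 g_le; have C_ge0 := pos_INR C.
(* Since [d >= 1], [(C + 1) ^ d >= C + 1 > C], so this constant works without a root of [C]. *)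
exists (/ (INR C + 1))%R; split; first by apply: Rinv_0_lt_compat; lra.
exists (maxn N 3) => n k; rewrite geq_max => /andP [le_Nn n_gt2].
move=> /(separating_of_local uH n_gt2) [k_gt0 [col sep]].
have {}g_le := g_le n k col le_Nn k_gt0 sep; have {}g_gt0 := g_gt0 n le_Nn.
have k_gt0' : (0 < INR k)%R by apply: lt_0_INR; apply/ltP.
pose x := Rpower (g n) a.
have x_gt0 : (0 < x)%R by apply: exp_pos.
have x_pow : (x ^ d = g n)%R.
  by rewrite -Rpower_pow // Rpower_mult ad Rpower_1.
have [x_le|x_gt] := Rle_or_lt x ((INR C + 1) * INR k)%R.
  apply: (Rmult_le_reg_l (INR C + 1)); first lra.
  by rewrite -Rmult_assoc Rinv_r ?Rmult_1_l //; lra.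
have kd_gt0 := pow_lt _ d k_gt0'.
have : (((INR C + 1) * INR k) ^ d <= g n)%R.
  rewrite -x_pow; apply: pow_incr; split; last lra.
  by apply: Rmult_le_pos; lra.
rewrite Rpow_mult_distr => le_g.
have C_le : (INR C + 1 <= (INR C + 1) ^ d)%R.
  rewrite -[X in (X <= _)%R]pow_1; apply: Rle_pow; first lra.
  exact/leP.
have := Rmult_le_compat_r _ _ _ (Rlt_le _ _ kd_gt0) C_le.
nra.
Qed.

Lemma big_Omega_root (H : hgraph) (a : R) (d C : nat) :
  0 < d -> (a * INR d = 1)%R -> three_uniform H ->
  (forall n k (col : nat -> seq nat -> 'I_k), 0 < k ->
     separating n H col -> n <= C * k ^ d) ->
  big_Omega 3 H (fun n => Rpower (INR n) a).
Proof.
move=> d_gt0 ad uH bound; apply: (@big_Omega_of_bound _ _ _ d C 1) => //.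
  by move=> n n_gt0; apply: lt_0_INR; apply/ltP.
move=> n k col _ k_gt0 sep; rewrite -INR_expn -mult_INR; apply/le_INR/leP.
exact: bound sep.
Qed.

(** By [k < 2 ^ k] the large power is at most [2 ^ (8 * k ^ 5)]; the exponent is rounded up to match
    the eighth root. *)
Lemma SP3_exp_bound (n k : nat) (col : nat -> seq nat -> 'I_k) :
  0 < k -> separating n SP3 col -> n <= 2 ^ (9 * k ^ 8).
Proof.
move=> k_gt0 /SP3_bound n_le; apply: leq_trans n_le _.
have k_lt : k < 2 ^ k by apply: ltn_expl.
have k_le i : 0 < i -> k <= k ^ i by move=> i_gt0; rewrite -[leqLHS]expn1 leq_pexp2l.
have kk : k * k <= 2 ^ (2 * k) by rewrite mul2n -addnn expnD leq_mul // ltnW.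
have k8 : 0 < k ^ 8 by rewrite expn_gt0 k_gt0.
have le1 : 2 * (k * k).+1 <= 2 ^ (8 * k ^ 8).
  apply: (@leq_trans (2 ^ (2 + 2 * k))).
    by rewrite expnD; nia.
  by rewrite leq_exp2l //; have := k_le 8 isT; lia.
have le2 : (k * k) ^ ((k * k).+1 * (k * k).+1) <= 2 ^ (8 * k ^ 8).
  apply: (@leq_trans ((2 ^ (2 * k)) ^ ((k * k).+1 * (k * k).+1))).
    by rewrite leq_exp2r.
  rewrite -expnM leq_exp2l //; apply: (@leq_trans (8 * k ^ 5)).
    have : (k * k).+1 <= 2 * (k * k) by nia.
    move=> /(fun h => leq_mul h h) /(leq_mul (leqnn (2 * k))) /leq_trans; apply.
    by rewrite !expnS expn0; lia.
  by rewrite leq_mul2l leq_pexp2l.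
apply: leq_trans (leq_add le1 le2) _.
by rewrite addnn -mul2n -expnS leq_exp2l //; lia.
Qed.

Lemma ln_le (x y : R) : (0 < x)%R -> (x <= y)%R -> (ln x <= ln y)%R.
Proof.
move=> x_gt0 [lt_xy|->]; last exact: Rle_refl.
exact/Rlt_le/ln_increasing.
Qed.

(** [ln 64 = 6 * ln 2 > 3 >= e], from [ln 2 > 1 / 2]. *)
Lemma ln_ln_ge1 (n : nat) : 64 <= n -> (1 <= ln (ln (INR n)))%R.
Proof.
move=> n_ge.
have ln_ge3 : (3 <= ln (INR n))%R.
  have -> : (3 = INR 6 * / 2)%R by rewrite /=; lra.
  apply: (@Rle_trans _ (ln (2 ^ 6))).
    by rewrite ln_pow; [have := ln_lt_2; rewrite /=; lra|lra].
  apply: ln_le; first by apply: pow_lt; lra.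
  have -> : (2 ^ 6 = INR 64)%R by rewrite /=; lra.
  by apply/le_INR/leP.
rewrite -[X in (X <= _)%R]ln_exp; apply: ln_le; first exact: exp_pos.
exact: Rle_trans exp_le_3 ln_ge3.
Qed.

Lemma big_Omega_SP3 :
  big_Omega 3 SP3 (fun n => Rpower (ln (INR n) / ln (ln (INR n))) (1 / 8))%R.
Proof.
have ln_gt0 n : 64 <= n -> (0 < ln (INR n))%R.
  move=> n_ge; rewrite -ln_1; apply: ln_increasing; first lra.
  by rewrite -[1%R]/(INR 1); apply/lt_INR/ltP; lia.
apply: (@big_Omega_of_bound _ _ _ 8 9 64) => //.
- by rewrite /=; lra.
- move=> n n_ge; apply: Rdiv_lt_0_compat; first exact: ln_gt0.
  by have := ln_ln_ge1 n_ge; lra.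
move=> n k col n_ge k_gt0 /(SP3_exp_bound k_gt0) n_le.
have ll := ln_ln_ge1 n_ge; have l := ln_gt0 n n_ge.
(* Division by [ln (ln n) >= 1] does not increase [ln n], and [ln n <= 9 * k ^ 8 * ln 2] with
   [ln 2 <= 1]. *)
apply: (@Rle_trans _ (ln (INR n))).
  apply: (Rmult_le_reg_r (ln (ln (INR n)))); first lra.
  rewrite /Rdiv Rmult_assoc Rinv_l; last lra.
  nra.
apply: (@Rle_trans _ (ln (INR 2 ^ (9 * k ^ 8)%N))).
  apply: ln_le; first by apply: lt_0_INR; apply/ltP; lia.
  by rewrite -INR_expn; apply/le_INR/leP.
rewrite ln_pow; last by rewrite /=; lra.
rewrite mult_INR INR_expn -[X in (_ <= X)%R]Rmult_1_r.
apply: Rmult_le_compat_l.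
  by apply: Rmult_le_pos; [exact: pos_INR|apply: pow_le; exact: pos_INR].
rewrite -[X in (_ <= X)%R]ln_exp; apply: ln_le; first by rewrite /=; lra.
have := exp_ineq1 1; rewrite /=; lra.
Qed.

Theorem theorem2 :
  big_Omega 3 SP3
    (fun n => Rpower (ln (INR n) / ln (ln (INR n))) (1 / 8))%R /\
  big_Omega 3 (SP1 4) (fun n => Rpower (INR n) (1 / 8))%R /\
  big_Omega 3 (SP2 4) (fun n => Rpower (INR n) (1 / 7))%R /\
  (forall t : nat, (5 <= t)%nat ->
     big_Omega 3 (SP1 t) (fun n => Rpower (INR n) (1 / 3))%R /\
     big_Omega 3 (SP2 t) (fun n => Rpower (INR n) (1 / 3))%R).
Proof.
split; first exact: big_Omega_SP3.
split; last split.
- apply: (@big_Omega_root _ _ 8 12) => //; first by rewrite /=; lra.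
  by move=> n k col; apply: SP1_4_bound.
- apply: (@big_Omega_root _ _ 7 8) => //; first by rewrite /=; lra.
  (* The exponent 6 is relaxed to the 7 of the statement. *)
  move=> n k col k_gt0 /(SP2_4_bound k_gt0) n_le; apply: leq_trans n_le _.
  by rewrite leq_mul2l leq_pexp2l.
move=> t t_ge5; split.
  apply: (@big_Omega_root _ _ 3 (16 + 2 * hv (SP1 t))) => //.
  - by rewrite /=; lra.
  - exact: three_uniform_SP_of sp1_s_homo.
  - by move=> n k col k_gt0; apply: SP1_bound.
apply: (@big_Omega_root _ _ 3 (16 + 2 * hv (SP2 t))) => //.
- by rewrite /=; lra.
- exact: three_uniform_SP_of sp2_s_homo.
- by move=> n k col k_gt0; apply: SP2_bound.
Qed.
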